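(* Let $G$ be a connected Lie group. Then for each positive integer $n$, all conjugacy classes of order $n$ in $G$ are closed (as subsets of $G$).
   Context: Lie groups are real and finite-dimensional; $e$ is the identity element. In this statement, for a positive integer $n$, an element $g$ of a Lie group $G$ is said to be of order $n$ if $g^n=e$ (it is not required that $n$ be minimal). A conjugacy class $\{hgh^{-1}\mid h\in G\}$ is of order $n$ if it contains an element of order $n$ (in which case all of its elements are of order $n$). *)

(* Defs.v *)
From HB Require Import structures.
From mathcomp Require Import all_boot all_order all_algebra.
From mathcomp Require Import all_classical all_reals all_analysis.

Set Implicit Arguments.
Unset Strict Implicit.
Unset Printing Implicit Defensive.

Import Order.TTheory GRing.Theory Num.Theory.
Import numFieldNormedType.Exports.

Local Open Scope classical_set_scope.
Local Open Scope ring_scope.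

(* [D] is meant to be open, so that differentiability and derivatives at a     *)
(* point of [D] do not depend on the values of [f] outside [D]. In finite      *)
(* dimension this is the usual notion of a C^k map: a C^k.+1 map is a          *)
(* differentiable one whose directional derivatives are all C^k.               *)
Fixpoint Ck_on (R : realType) (E F : normedModType R) (k : nat) (D : set E)
    (f : E -> F) : Prop :=
  if k is k'.+1 then
    (forall x, D x -> differentiable f x) /\
    (forall v : E, Ck_on k' D ('D_v f))
  else forall x, D x -> {for x, continuous f}.

Definition smooth_on (R : realType) (E F : normedModType R) (D : set E)
    (f : E -> F) : Prop :=
  forall k, Ck_on k D f.

(* Charts of [M] with values in [E]; [chart_map] and [chart_inv] are total     *)
(* functions, only meaningful on [chart_dom] and [chart_cod] respectively.     *)
Record chart (E M : Type) := Chart {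
  chart_dom : set M;
  chart_cod : set E;
  chart_map : M -> E;
  chart_inv : E -> M }.

Definition is_chart (E M : topologicalType) (c : chart E M) : Prop :=
  [/\ open (chart_dom c) /\ open (chart_cod c),
      (forall x, chart_dom c x ->
         chart_cod c (chart_map c x) /\ chart_inv c (chart_map c x) = x),
      (forall y, chart_cod c y ->
         chart_dom c (chart_inv c y) /\ chart_map c (chart_inv c y) = y),
      (forall x, chart_dom c x -> {for x, continuous (chart_map c)}) &
      (forall y, chart_cod c y -> {for y, continuous (chart_inv c)})].

Definition smooth_atlas (R : realType) (E : normedModType R)
    (M : topologicalType) (A : set (chart E M)) : Prop :=
  [/\ (forall c, A c -> is_chart c),
      (forall x : M, exists2 c, A c & chart_dom c x) &
      (forall a b, A a -> A b ->
         smooth_on (chart_map a @` (chart_dom a `&` chart_dom b))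
                   (chart_map b \o chart_inv a))].

Definition smooth_map (R : realType) (E F : normedModType R)
    (M N : topologicalType) (A : set (chart E M)) (B : set (chart F N))
    (f : M -> N) : Prop :=
  continuous f /\
  (forall a b, A a -> B b ->
     smooth_on (chart_map a @` (chart_dom a `&` f @^-1` chart_dom b))
               (chart_map b \o f \o chart_inv a)).

Definition prod_chart (E F M N : Type) (a : chart E M) (b : chart F N) :
    chart (E * F) (M * N) :=
  Chart (chart_dom a `*` chart_dom b) (chart_cod a `*` chart_cod b)
        (fun p => (chart_map a p.1, chart_map b p.2))
        (fun p => (chart_inv a p.1, chart_inv b p.2)).

Definition prod_atlas (E F M N : Type) (A : set (chart E M))
    (B : set (chart F N)) : set (chart (E * F) (M * N)) :=
  [set c | exists a b, [/\ A a, B b & c = prod_chart a b]].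

HB.structure Definition GroupTopological := {G of Group G & Topological G}.

HB.mixin Record GroupTopological_isLieGroup (R : realType) (d : nat) G
    of GroupTopological G := {
  lie_atlas : set (chart 'rV[R]_d G);
  lie_atlasP : smooth_atlas lie_atlas;
  lie_hausdorff : hausdorff_space G;
  lie_second_countable : @second_countable G;
  lie_mul_smooth :
    smooth_map (prod_atlas lie_atlas lie_atlas) lie_atlas
               (fun p : G * G => (p.1 * p.2)%g);
  lie_inv_smooth : smooth_map lie_atlas lie_atlas (fun x : G => (x^-1)%g) }.

#[short(type="lieGroupType")]
HB.structure Definition LieGroup (R : realType) (d : nat) :=
  {G of GroupTopological G & GroupTopological_isLieGroup R d G}.

Definition conjugacy_class (G : groupType) (g : G) : set G :=
  [set (h * g * h^-1)%g | h in [set: G]].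

Definition is_conjugacy_class (G : groupType) (C : set G) : Prop :=
  exists g : G, C = conjugacy_class g.

(* [n] need not be the least exponent killing [g]. *)
Definition elt_of_order (G : groupType) (n : nat) (g : G) : Prop :=
  (g ^+ n)%g = 1%g.

Definition class_of_order (G : groupType) (n : nat) (C : set G) : Prop :=
  exists2 g, C g & elt_of_order n g.

(* Main.v *)
Require Import Defs.
From HB Require Import structures.
From mathcomp Require Import all_boot all_order all_algebra.
From mathcomp Require Import lra.
From mathcomp Require Import all_classical all_reals all_analysis.

(** The elements killed by [n] form a closed set, so a conjugacy class of order
    [n] is closed as soon as every such class is open in that set. This is the
    rigidity statement [torsion_locally_conjugate]: if [x ^+ n = 1], every [y]
    close enough to [x] with [y ^+ n = 1] is conjugate to [x].

    The equation [y = k x k^-1] says that [k] is fixed by [k |-> y k x^-1]. When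
    [x] and [y] are killed by [n] the [n]-th iterate of this map is the identity,
    and for [y = x] it fixes [1]. Read in a chart around [1], the maps form a
    family [F_t] of [n]-periodic maps, with [F_t0 u0 = u0], and a fixed point of
    [F_t] near [u0] has to be found for [t] near [t0]. Let [A] be the derivative
    of [F_t0] at [u0], so that [A^n = id]. The averaging device with which
    Bochner linearizes compact group actions gives
      [Phi_t u = sum_(i < n) A^(n - i) (F_t^i u - u0)],
    which satisfies [Phi_t o F_t = A o Phi_t] and is, near [u0] and uniformly in
    [t] near [t0], a small Lipschitz perturbation of [n * id]. Hence [Phi_t] is
    injective near [u0] and, by the contraction principle, has a zero [u] there;
    then [F_t u] is another zero, so [F_t u = u]. This is
    [periodic_family_fixpoint].

    The differential calculus needed is a single notion, strict
    differentiability in one variable uniformly in a parameter. It is stable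
    under composition ([strict_diff_comp]) and follows from the mean value
    theorem for C^1 maps such as the multiplication of [G] read in charts
    ([C1_strict_diff], [mulg_in_charts_C1]). *)

Set Implicit Arguments.
Unset Strict Implicit.
Unset Printing Implicit Defensive.

Import Order.TTheory GRing.Theory Num.Theory.
Import numFieldNormedType.Exports.

Local Open Scope classical_set_scope.
Local Open Scope ring_scope.

(** * Strict differentiability of families of maps *)

(* Joins the norm and the completeness of row vectors. *)
HB.instance Definition _ (R : realType) d := NormedModule.on 'rV[R]_d.

Fact iter_is_linear (R : nzRingType) (E : lmodType R) (n : nat) (A : {linear E -> E}) :
  linear (iter n A).
Proof. by elim: n => [|n IHn] a u v //=; rewrite IHn linearP. Qed.
HB.instance Definition _ (R : nzRingType) (E : lmodType R) (n : nat)
    (A : {linear E -> E}) :=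
  GRing.isLinear.Build R E E *:%R (iter n A) (iter_is_linear n A).

(** Strict differentiability at [v0], uniformly for [t] near [t0]: both [u] and
    [v] move. Unlike plain differentiability it makes [f t] an almost linear
    Lipschitz map on a whole neighbourhood of [v0], also for [t != t0]. *)
Definition strict_diff (R : realType) (T : topologicalType) (V W : normedModType R)
  (f : T -> V -> W) (t0 : T) (v0 : V) (L : V -> W) :=
  forall e : R, 0 < e -> \forall p \near (t0, (v0, v0)),
  `|f p.1 p.2.1 - f p.1 p.2.2 - L (p.2.1 - p.2.2)| <= e * `|p.2.1 - p.2.2|.

Lemma cvg_prod_nbhs (I : Type) (F : set_system I) (U V : topologicalType)
    {FF : Filter F} (f : I -> U) (g : I -> V) (a : U) (b : V) :
  f x @[x --> F] --> a -> g x @[x --> F] --> b ->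
  (f x, g x) @[x --> F] --> (a, b).
Proof. by move=> fa gb; exact: (cvg_pair fa gb). Qed.

Lemma cvg_fst_nbhs (U V : topologicalType) (p : U * V) :
  q.1 @[q --> p] --> p.1.
Proof. by case: p => a b; exact: (@cvg_fst _ _ (nbhs a) (nbhs b)). Qed.

Lemma cvg_snd_nbhs (U V : topologicalType) (p : U * V) :
  q.2 @[q --> p] --> p.2.
Proof. by case: p => a b; exact: (@cvg_snd _ _ (nbhs a) (nbhs b)). Qed.

Definition jointly_continuous_at (T V W : topologicalType) (f : T -> V -> W)
  (t0 : T) (v0 : V) := f p.1 p.2 @[p --> (t0, v0)] --> f t0 v0.

Lemma jointly_continuous_comp (T V W X : topologicalType) (f : T -> V -> W)
    (g : T -> W -> X) t0 v0 :
  jointly_continuous_at f t0 v0 -> jointly_continuous_at g t0 (f t0 v0) ->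
  jointly_continuous_at (fun t => g t \o f t) t0 v0.
Proof.
move=> cf cg; rewrite /jointly_continuous_at /=.
apply: (@cvg_comp _ _ _ (fun p : T * V => (p.1, f p.1 p.2))
  (fun q : T * W => g q.1 q.2) _ (nbhs (t0, f t0 v0))) cg => //.
by apply: cvg_prod_nbhs; [exact: cvg_fst|].
Qed.

Section strict.
Context (R : realType) (T : topologicalType).
Implicit Types V W X : normedModType R.

Lemma near_both V (t0 : T) (v0 : V) (P : T -> V -> Prop) :
  (\forall p \near (t0, v0), P p.1 p.2) ->
  \forall p \near (t0, (v0, v0)), P p.1 p.2.1 /\ P p.1 p.2.2.
Proof.
have h1 : (p.1, p.2.1) @[p --> (t0, (v0, v0))] --> (t0, v0).
  apply: cvg_prod_nbhs; first exact: cvg_fst_nbhs.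
  by apply: (cvg_comp _ _ (@cvg_snd_nbhs _ _ _)); exact: cvg_fst_nbhs.
have h2 : (p.1, p.2.2) @[p --> (t0, (v0, v0))] --> (t0, v0).
  apply: cvg_prod_nbhs; first exact: cvg_fst_nbhs.
  by apply: (cvg_comp _ _ (@cvg_snd_nbhs _ _ _)); exact: cvg_snd_nbhs.
move=> nP; near=> p; split; near: p; [exact: h1 nP|exact: h2 nP].
Unshelve. all: by end_near. Qed.

(** The chain rule. The increment of [g t \o f t] differs from its linear part by
    the error of [g t] on [f t u - f t v], plus [K] applied to the error of
    [f t]. *)
Lemma strict_diff_comp V W X (f : T -> V -> W) (g : T -> W -> X) t0 v0
    (L : {linear V -> W}) (K : {linear W -> X}) :
  continuous L -> continuous K -> jointly_continuous_at f t0 v0 ->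
  strict_diff f t0 v0 L -> strict_diff g t0 (f t0 v0) K ->
  strict_diff (fun t => g t \o f t) t0 v0 (K \o L).
Proof.
move=> /linear_lipschitz[l l0 Ll] /linear_lipschitz[k k0 Kk] cf df dg e e0.
(* Half of [e] goes to each error; [l + e / (2 * k)] is the Lipschitz constant
   of [f t] that the first choice yields. *)
have d0 : 0 < e / (2 * k) by rewrite divr_gt0 // mulr_gt0.
have d1 : 0 < e / (2 * (l + e / (2 * k))).
  by rewrite divr_gt0 // mulr_gt0 // addr_gt0.
have h : (p.1, (f p.1 p.2.1, f p.1 p.2.2)) @[p --> (t0, (v0, v0))] -->
    (t0, (f t0 v0, f t0 v0)).
  apply: cvg_prod_nbhs; first exact: cvg_fst_nbhs.
  apply: cvg_prod_nbhs => A nA;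
    have := @near_both _ _ _ (fun t v => A (f t v)) (cf A nA).
    by apply: filterS => p [].
  by apply: filterS => p [].
near=> p.
have dfp : `|f p.1 p.2.1 - f p.1 p.2.2 - L (p.2.1 - p.2.2)| <=
    e / (2 * k) * `|p.2.1 - p.2.2| by near: p; exact: df.
have dgp : `|g p.1 (f p.1 p.2.1) - g p.1 (f p.1 p.2.2) -
    K (f p.1 p.2.1 - f p.1 p.2.2)| <=
    e / (2 * (l + e / (2 * k))) * `|f p.1 p.2.1 - f p.1 p.2.2|.
  by near: p; exact: (h _ (dg _ d1)).
set u := p.2.1 in dfp dgp *; set v := p.2.2 in dfp dgp *.
have fuv : `|f p.1 u - f p.1 v| <= (l + e / (2 * k)) * `|u - v|.
  rewrite -[X in `|X|](subrK (L (u - v))) (le_trans (ler_normD _ _)) //.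
  by rewrite mulrDl addrC lerD.
have -> : (g p.1 \o f p.1) u - (g p.1 \o f p.1) v - (K \o L) (u - v) =
    (g p.1 (f p.1 u) - g p.1 (f p.1 v) - K (f p.1 u - f p.1 v)) +
    K (f p.1 u - f p.1 v - L (u - v)).
  by rewrite [K (f p.1 u - f p.1 v - _)]linearB addrA subrK.
rewrite (le_trans (ler_normD _ _)) // [e in leRHS]splitr mulrDl lerD //.
  rewrite (le_trans dgp) // (le_trans (ler_wpM2l (ltW d1) fuv)) //.
  rewrite mulrA invfM mulrA mulfVK // gt_eqF //; exact: addr_gt0.
rewrite (le_trans (Kk _)) // (le_trans (ler_wpM2l (ltW k0) dfp)) //.
by rewrite mulrA invfM mulrCA [k * (2^-1 * _)]mulrCA mulfV ?gt_eqF // mulr1.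
Unshelve. all: by end_near. Qed.

Lemma strict_diff_affine V W (f : T -> V -> W) t0 v0 (L : V -> W) :
  (forall t u v, f t u - f t v = L (u - v)) -> strict_diff f t0 v0 L.
Proof.
move=> fL e e0; near=> p.
by rewrite fL subrr normr0 mulr_ge0 // ltW.
Unshelve. all: by end_near. Qed.

Lemma strict_diff_sum V W (I : finType) (f : I -> T -> V -> W) t0 v0
    (L : I -> V -> W) :
  (forall i, strict_diff (f i) t0 v0 (L i)) ->
  strict_diff (fun t v => \sum_i f i t v) t0 v0 (fun v => \sum_i L i v).
Proof.
move=> df e e0; pose c : R := #|I|%:R + 1.
have c0 : 0 < c by rewrite ltr_wpDl.
near=> p.
have dfp i : `|f i p.1 p.2.1 - f i p.1 p.2.2 - L i (p.2.1 - p.2.2)| <=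
    e / c * `|p.2.1 - p.2.2|.
  move: i; near: p; apply: filter_forall => i; apply: df; exact: divr_gt0.
rewrite -!sumrB (le_trans (ler_norm_sum _ _ _)) //.
apply: le_trans; first by apply: ler_sum => i _; exact: dfp.
rewrite sumr_const -mulr_natl mulrA ler_wpM2r // mulrCA ler_piMr ?(ltW e0) //.
by rewrite ler_pdivrMr // mul1r lerDl.
Unshelve. all: by end_near. Qed.

(** A linear map that agrees with the identity up to [e * `|w|] on all small [w],
    for each [e], is the identity. This yields [A^n = id] from the periodicity of
    the single map at [t0]. *)
Lemma strict_diff_id_unique V (f : T -> V -> V) t0 v0 (L : {linear V -> V}) :
  strict_diff f t0 v0 L -> (\forall v \near v0, f t0 v = v) ->
  forall w, L w = w.
Proof.
move=> df fid w; apply/eqP; rewrite -subr_eq0 -normr_le0.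
apply/ler_addgt0Pr => e e0; rewrite add0r.
pose d := e / (`|w| + 1).
have d0 : 0 < d by rewrite divr_gt0 // ltr_wpDl.
have h1 : s *: w + v0 @[s --> (0 : R)] --> v0.
  rewrite -[X in _ --> X]add0r -[in X in _ --> X](scale0r w).
  apply: cvgD; last exact: cvg_cst.
  by apply: cvgZl; exact: cvg_id.
have h : (t0, (s *: w + v0, v0)) @[s --> (0 : R)] --> (t0, (v0, v0)).
  by apply: cvg_prod_nbhs; [exact: cvg_cst|apply: cvg_prod_nbhs => //; exact: cvg_cst].
near (0 : R)^' => s.
have s0 : s != 0 by near: s; exact: nbhs_dnbhs_neq.
have : `|f t0 (s *: w + v0) - f t0 v0 - L (s *: w + v0 - v0)| <=
    d * `|s *: w + v0 - v0|.
  by near: s; apply: cvg_within; exact: (h _ (df _ d0)).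
have -> : f t0 (s *: w + v0) = s *: w + v0.
  by near: s; apply: cvg_within; exact: (h1 _ fid).
rewrite (nbhs_singleton fid) addrK linearZ /= -scalerBr !normrZ distrC.
rewrite mulrCA ler_pM2l ?normr_gt0 // => /le_trans -> //.
rewrite mulrAC ler_pdivrMr ?ltr_wpDl // ler_wpM2l ?(ltW e0) //.
by rewrite lerDl.
Unshelve. all: by end_near. Qed.

End strict.

(** * Fixed points of periodic families *)

(** Exchanges a neighbourhood in the product for a radius chosen before [t]. *)
Lemma near_pair_ball (R : realType) (T : topologicalType)
    (V : normedModType R) (t0 : T) (v0 : V) (P : T * V -> Prop) :
  (\forall p \near (t0, v0), P p) ->
  exists2 r : R, 0 < r &
    \forall t \near t0, forall v, `|v - v0| <= r -> P (t, v).
Proof.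
case=> -[A B] /= [nA /nbhs_ballP[r /= r0 rB] AB]; exists (r / 2).
  exact: divr_gt0.
apply: filterS nA => t At v vr; apply: AB; split => //=; apply: rB.
rewrite -ball_normE /ball_ /= distrC (le_lt_trans vr) //.
by rewrite ltr_pdivrMr // ltr_pMr // ltr1n.
Qed.

(** The centre is moved by at most [r / 2] and distances are halved, so the closed
    ball is stable and the contraction principle applies in it. *)
Lemma half_contraction_fixpoint (R : realType) (X : completeNormedModType R)
    (f : X -> X) (x0 : X) (r : R) : 0 < r ->
  (forall u v, `|u - x0| <= r -> `|v - x0| <= r ->
     `|f u - f v| <= 2^-1 * `|u - v|) ->
  `|f x0 - x0| <= r / 2 ->
  exists2 p, `|p - x0| <= r & f p = p.
Proof.
move=> r0 fK fx0; pose U := [set u | `|u - x0| <= r].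
have fU : set_fun U U f.
  move=> u /= ur; rewrite /U /= -(subrK (f x0) (f u)) -addrA [leRHS]splitr.
  rewrite (le_trans (ler_normD _ _)) // lerD //.
  rewrite (le_trans (fK _ _ ur _)) ?subrr ?normr0 ?(ltW r0) //.
  by rewrite mulrC ler_wpM2r.
pose g : {fun U >-> U} := mkfun fU.
have Ucl : closed U.
  rewrite (_ : U = (fun u => `|u - x0|) @^-1` [set y | y <= r]) //.
  apply: closed_comp; last exact: closed_le.
  move=> u _; apply: cvg_norm; apply: cvgB; [exact: cvg_id|exact: cvg_cst].
have [|||p Up pE] := @banach_fixed_point _ _ _ g.
- exists 2^-1%:nng; split => /=; first by rewrite invf_lt1 // ltr1n.
  by move=> [u v] /= [ur vr]; exact: fK.
- exact: Ucl.
- by exists x0; rewrite /U /= subrr normr0 ltW.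
- by exists p.
Qed.

Section periodic.
Context (R : realType) (T : topologicalType) (E : completeNormedModType R).
Variables (F : T -> E -> E) (t0 : T) (u0 : E) (A : {linear E -> E}).
Hypotheses (cA : continuous A) (F0 : F t0 u0 = u0).
Hypotheses (cF : jointly_continuous_at F t0 u0) (dF : strict_diff F t0 u0 A).

Lemma continuous_iter_linear i : continuous (iter i A).
Proof.
elim: i => [|i IHi] x /=; first exact: cvg_id.
by apply: continuous_comp; [exact: IHi|exact: cA].
Qed.

Lemma iter_fix i : iter i (F t0) u0 = u0.
Proof. by elim: i => //= i ->. Qed.

Lemma jointly_continuous_iter i :
  jointly_continuous_at (fun t => iter i (F t)) t0 u0.
Proof.
elim: i => [|i IHi]; first exact: cvg_snd_nbhs.
apply: (@jointly_continuous_comp _ _ _ _ (fun t => iter i (F t)) F) => //.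
by rewrite iter_fix.
Qed.

Lemma strict_diff_iter i :
  strict_diff (fun t => iter i (F t)) t0 u0 (iter i A).
Proof.
elim: i => [|i IHi]; first exact: strict_diff_affine.
apply: (@strict_diff_comp _ _ _ _ _ (fun t => iter i (F t)) F _ _ (iter i A) A) => //.
- exact: continuous_iter_linear.
- exact: jointly_continuous_iter.
- by rewrite iter_fix.
Qed.

Variables (n : nat).

(** Up to a factor [n], the average of the maps [A^-i \o F t^i] recentred at [u0];
    [A^(n - i)] stands for [A^-i] because [A^n = id]. *)
Definition bochner_map (t : T) (u : E) : E :=
  \sum_(i < n) iter (n - i) A (iter i (F t) u - u0).

(** Both sides are sums of [h i = A^(n + 1 - i) (F t^i u - u0)], over
    [1 <= i <= n] and over [0 <= i < n]; periodicity makes [h n = h 0]. *)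
Lemma bochner_map_equivariant t u : iter n (F t) u = u ->
  (forall w, iter n A w = w) ->
  bochner_map t (F t u) = A (bochner_map t u).
Proof.
move=> Fn An; rewrite /bochner_map linear_sum.
pose h i := iter (n.+1 - i) A (iter i (F t) u - u0).
rewrite (eq_bigr (fun i : 'I_n => h i.+1)); last first.
  by move=> i _; rewrite /h subSS -iterSr.
rewrite [RHS](eq_bigr (fun i : 'I_n => h i)); last first.
  by move=> i _; rewrite /h subSn //; exact: ltnW.
apply: (addrI (h 0%N)).
rewrite -(big_ord_recl n (fun i => h i)) big_ord_recr /= addrC; congr (_ + _).
by rewrite /h subn0 subSnn /= Fn An.
Qed.

Lemma strict_diff_bochner_map : (forall w, iter n A w = w) ->
  strict_diff bochner_map t0 u0 (fun w => w *+ n).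
Proof.
move=> An.
have -> : (fun w => w *+ n) = (fun w => \sum_(i < n) (iter (n - i) A \o iter i A) w).
  apply/funext => w; rewrite (eq_bigr (fun=> w)); last first.
    by move=> i _; rewrite /= -iterD subnK // ltnW.
  by rewrite sumr_const card_ord.
apply: strict_diff_sum => i.
apply: (@strict_diff_comp _ _ _ _ _ (fun t => iter i (F t))
  (fun _ w => iter (n - i) A (w - u0)) _ _ (iter i A) (iter (n - i) A)).
- exact: continuous_iter_linear.
- exact: continuous_iter_linear.
- exact: jointly_continuous_iter.
- exact: strict_diff_iter.
- by apply: strict_diff_affine => _ u v; rewrite -linearB opprB addrA subrK.
Qed.

Lemma bochner_map_cvg0 : bochner_map t u0 @[t --> t0] --> (0 : E).
Proof.
rewrite -[X in _ --> X](_ : \sum_(i < n) 0 = _); last by rewrite big1_eq.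
apply: cvg_big => [|i _]; first by move=> x; exact: add_continuous.
rewrite -[X in _ --> X](linear0 (iter (n - i) A)).
apply: continuous_cvg; first exact: continuous_iter_linear.
rewrite -[X in _ --> X](subrr u0); apply: cvgB; last exact: cvg_cst.
have h : (t, u0) @[t --> t0] --> (t0, u0).
  by apply: cvg_prod_nbhs; [exact: cvg_id|exact: cvg_cst].
have := cvg_comp _ _ h (@jointly_continuous_iter i).
by rewrite iter_fix.
Qed.

(** Periodicity is restricted to parameters in [S] because, for conjugation, only
    the elements killed by [n] give periodic maps, and these need not fill a
    neighbourhood of [x]. *)
Lemma periodic_family_fixpoint (S : set T) (U : set E) :
  (0 < n)%N -> S t0 ->
  (\forall p \near (t0, u0), S p.1 -> iter n (F p.1) p.2 = p.2) ->
  nbhs u0 U ->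
  \forall t \near t0, S t -> exists2 u, U u & F t u = u.
Proof.
move=> n0 St0 Fn nU.
have n0R : 0 < n%:R :> R by rewrite ltr0n.
have An : forall w, iter n A w = w.
  apply: (@strict_diff_id_unique _ _ _ (fun t => iter n (F t)) t0 u0 (iter n A)).
    exact: strict_diff_iter.
  have h : (t0, u) @[u --> u0] --> (t0, u0).
    by apply: cvg_prod_nbhs; [exact: cvg_cst|exact: cvg_id].
  exact: (filterS (fun u Hu => Hu St0) (h _ Fn)).
have e0 : 0 < n%:R / 2 :> R by exact: divr_gt0.
have [r r0 dPhi] := near_pair_ball (strict_diff_bochner_map An e0).
have nr : \forall p \near (t0, u0), U p.2 /\
    (S p.1 -> iter n (F p.1) p.2 = p.2) /\ `|F p.1 p.2 - u0| <= r.
  near=> p; split; first by near: p; exact: (@cvg_snd_nbhs _ _ (t0, u0) _ nU).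
  split; first by near: p.
  rewrite distrC; near: p; apply: cvgr_dist_le => //.
  by rewrite -[X in _ --> X]F0.
have [r' r'0 nr'] := near_pair_ball nr.
pose m := Num.min r r'.
have m0 : 0 < m by rewrite lt_min r0.
near=> t => St.
have Pt : forall v, `|v - (u0, u0)| <= r ->
  `|bochner_map t v.1 - bochner_map t v.2 - (v.1 - v.2) *+ n| <=
  n%:R / 2 * `|v.1 - v.2| by near: t.
have {}Pt u v : `|u - u0| <= r -> `|v - u0| <= r ->
    `|bochner_map t u - bochner_map t v - (u - v) *+ n| <=
    n%:R / 2 * `|u - v|.
  by move=> ur vr; apply: (Pt (u, v)); rewrite prod_normE /= ge_max ur.
have Qt : forall u, `|u - u0| <= r' -> U u /\
    (S t -> iter n (F t) u = u) /\ `|F t u - u0| <= r by near: t.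
have small : `|bochner_map t u0| <= n%:R * (m / 2).
  rewrite -[bochner_map t u0]subr0 distrC; near: t.
  apply: cvgr_dist_le; first exact: bochner_map_cvg0.
  by rewrite mulr_gt0 // divr_gt0.
(* A zero of the Bochner map is a fixed point of [id - Phi_t / n], whose
   derivative at [u0] vanishes for [t = t0]. *)
have [|||u um uE] := @half_contraction_fixpoint _ _
    (fun u => u - n%:R^-1 *: bochner_map t u) u0 m.
- exact: m0.
- move=> u v; rewrite !le_min => /andP[ur _] /andP[vr _].
  have -> : u - n%:R^-1 *: bochner_map t u - (v - n%:R^-1 *: bochner_map t v) =
      - (n%:R^-1 *: (bochner_map t u - bochner_map t v - (u - v) *+ n)).
    rewrite -[(u - v) *+ n]scaler_nat [in RHS]scalerBr scalerA mulVf ?gt_eqF // scale1r.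
    by rewrite scalerBr !opprB addrACA [in RHS]addrACA [- v + _]addrC.
  rewrite normrN normrZ gtr0_norm ?invr_gt0 // ler_pdivrMl //.
  by rewrite mulrA Pt.
- rewrite addrAC subrr add0r normrN normrZ gtr0_norm ?invr_gt0 //.
  by rewrite ler_pdivrMl.
have Phi0 : bochner_map t u = 0.
  apply/eqP; move: uE => /eqP; rewrite -subr_eq0 addrAC subrr add0r oppr_eq0.
  by rewrite scaler_eq0 invr_eq0 gt_eqF.
move: um; rewrite le_min => /andP[ur /Qt[Uu [/(_ St) Ftn Ftu]]].
(* [u] and [F t u] are zeros at which the Bochner map is injective. *)
exists u => //; apply/eqP; rewrite -subr_eq0 -normr_le0.
have := Pt _ _ Ftu ur.
rewrite bochner_map_equivariant // Phi0 linear0 subrr sub0r normrN -scaler_nat.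
rewrite normrZ ger0_norm // distrC -mulrA ler_pM2l //.
by move: (`|_|) => x; lra.
Unshelve. all: by end_near. Qed.
End periodic.

(** * C^1 maps are strictly differentiable *)

Section C1.
Context (R : realType) (V : normedModType R) (d : nat) (f : V -> 'rV[R]_d).

Lemma rV_norm_le (d' : nat) (v : 'rV[R]_d') (c : R) :
  0 <= c -> (forall j, `|v 0 j| <= c) -> `|v| <= c.
Proof.
move=> c0 vc; rewrite [`|v|]mx_normrE; apply: bigmax_le => // -[i j] _ /=.
by rewrite ord1.
Qed.

Lemma ler_coord_norm (d' : nat) (v : 'rV[R]_d') j : `|v 0 j| <= `|v|.
Proof.
by rewrite [`|v|]mx_normrE; apply: (@le_bigmax_cond _ _ _ _ (0, j)).
Qed.

(** With the sup norm on row vectors, the scalar mean value theorem can be applied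
    to each coordinate, at intermediate points that depend on it. *)
Lemma mean_value_segment (L : V -> 'rV[R]_d) (w v : V) (c : R) :
  (forall s : R, 0 <= s <= 1 -> differentiable f (s *: v + w) /\
     `|'d f (s *: v + w) v - L v| <= c) ->
  `|f (v + w) - f w - L v| <= c.
Proof.
move=> dfc.
have c0 : 0 <= c by apply: le_trans (dfc 0 _).2; rewrite ?lexx ?ler01.
apply: rV_norm_le => // j.
pose g (s : R) : R := f (s *: v + w) 0 j.
have dg (s : R) : 0 <= s <= 1 -> is_derive s 1 g (('d f (s *: v + w) v) 0 j).
  move=> /dfc[dfs _].
  have coordL : linear (fun x : 'rV[R]_d => x 0 j : R).
    by move=> k x y; rewrite !mxE.
  pose cL : {linear 'rV[R]_d -> R} := HB.pack (fun x : 'rV[R]_d => x 0 j : R)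
    (GRing.isLinear.Build _ _ _ _ _ coordL).
  have ccL : continuous cL by exact: coord_continuous.
  have h1 : is_diff s (fun s : R => s *: v + w) (fun s : R => s *: v).
    rewrite -[X in is_diff _ _ X]addr0.
    exact: is_diffD.
  have h2 : is_diff (s *: v + w) f ('d f (s *: v + w)) by exact: DiffDef.
  have h3 : is_diff (f (s *: v + w)) cL cL.
    apply: DiffDef; first exact: linear_differentiable.
    exact: diff_lin.
  have h4 := @is_diff_comp _ _ _ _ _ _ _ _ _ h1 h2.
  have [dgs dgE] := @is_diff_comp _ _ _ _ _ _ _ _ _ h4 h3.
  apply: DeriveDef; first exact: diff_derivable.
  by rewrite deriveE // dgE /= scale1r.
have cg : {within `[0, 1], continuous g}.
  apply: derivable_within_continuous => s; rewrite in_itv /= => s01.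
  by case: (dg s s01).
have [||s s01 gE] := @MVT_segment R g (fun s => ('d f (s *: v + w) v) 0 j) 0 1 ler01.
- move=> s; rewrite in_itv /= => /andP[s0 s1]; apply: dg.
  by rewrite !ltW.
- exact: cg.
move: gE; rewrite /g scale1r scale0r add0r subr0 mulr1 => gE.
rewrite !mxE gE; move: s01; rewrite in_itv /= => /dfc[_].
by apply: le_trans; rewrite (le_trans _ (ler_coord_norm _ j)) // !mxE.
Qed.

(** Continuity of the finitely many derivatives ['D_(b i) f] makes [z |-> 'd f z]
    continuous in operator norm, and the mean value inequality concludes. The
    family [b] with its coordinate functions [x] states that [V] is
    finite-dimensional without fixing its form: a product of two spaces of row
    vectors is meant. *)
Lemma C1_strict_diff (I : finType) (b : I -> V) (x : I -> V -> R) (D : set V)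
    (z0 : V) (T : topologicalType) (t0 : T) :
  (forall v, v = \sum_i x i v *: b i) -> (forall i v, `|x i v| <= `|v|) ->
  open D -> Ck_on 1 D f -> D z0 ->
  strict_diff (fun _ : T => f) t0 z0 ('d f z0).
Proof.
move=> vE xv oD [df cdf] Dz0 e e0.
pose c : R := #|I|%:R + 1.
have c0 : 0 < c by rewrite ltr_wpDl.
have ec0 : 0 < e / c by exact: divr_gt0.
have nD : \forall z \near z0, D z /\
    forall i, `|'D_(b i) f z - 'D_(b i) f z0| <= e / c.
  near=> z; split; first by near: z; exact: open_nbhs_nbhs.
  move=> i; rewrite distrC; move: i; near: z; apply: filter_forall => i.
  by apply: cvgr_dist_le => //; exact: (cdf (b i)).
have {}nD : \forall z \near z0, D z /\
    forall v, `|'d f z v - 'd f z0 v| <= e * `|v|.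
  apply: filterS nD => z [Dz Db]; split => // v.
  have -> : 'd f z v - 'd f z0 v =
      \sum_i ('d f z (x i v *: b i) - 'd f z0 (x i v *: b i)).
    by rewrite sumrB -!linear_sum -vE.
  apply: le_trans (ler_norm_sum _ _ _) _.
  apply: (@le_trans _ _ (\sum_(i : I) `|v| * (e / c))).
    apply: ler_sum => i _; rewrite (linearZZ ('d f z)) (linearZZ ('d f z0)) -scalerBr normrZ.
    apply: ler_pM => //; rewrite -!deriveE //; exact: df.
  rewrite sumr_const -[leLHS]mulr_natl mulrCA [leRHS]mulrC ler_wpM2l //.
  by rewrite mulrA ler_pdivrMr // mulrC ler_wpM2l ?(ltW e0) // lerDl.
move: nD => /nbhs_ballP[r /= r0 rD].
have h : (p.2.1, p.2.2) @[p --> (t0, (z0, z0))] --> (z0, z0).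
  apply: cvg_prod_nbhs; apply: (cvg_comp _ _ (@cvg_snd_nbhs _ _ _)).
    exact: cvg_fst_nbhs.
  exact: cvg_snd_nbhs.
have nr : \forall q \near (z0, z0), ball z0 r q.1 /\ ball z0 r q.2.
  exists (ball z0 r, ball z0 r); last by move=> q [].
  by split; exact: nbhsx_ballx.
near=> p.
have [] : ball z0 r p.2.1 /\ ball z0 r p.2.2 by near: p; exact: h nr.
rewrite -!ball_normE /ball_ /= => ur vr.
rewrite -[in f p.2.1](subrK p.2.2 p.2.1).
apply: mean_value_segment => s /andP[s0 s1].
have [Dz zv] : D (s *: (p.2.1 - p.2.2) + p.2.2) /\ forall v,
    `|'d f (s *: (p.2.1 - p.2.2) + p.2.2) v - 'd f z0 v| <= e * `|v|.
  apply: rD; rewrite -ball_normE /ball_ /=.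
  have -> : z0 - (s *: (p.2.1 - p.2.2) + p.2.2) =
      s *: (z0 - p.2.1) + (1 - s) *: (z0 - p.2.2).
    rewrite scalerBl scale1r addrCA -scalerBr [- (z0 - p.2.2)]opprB [RHS]addrC.
    have -> : z0 - p.2.1 + (p.2.2 - z0) = p.2.2 - p.2.1.
      by rewrite addrC addrA subrK.
    by rewrite opprD addrA -scalerN opprB addrAC [RHS]addrC.
  rewrite (le_lt_trans (ler_normD _ _)) // !normrZ ger0_norm // ger0_norm ?subr_ge0 //.
  have : s * `|z0 - p.2.1| <= s * Num.max `|z0 - p.2.1| `|z0 - p.2.2|.
    by rewrite ler_wpM2l // le_max lexx.
  have : (1 - s) * `|z0 - p.2.2| <= (1 - s) * Num.max `|z0 - p.2.1| `|z0 - p.2.2|.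
    by rewrite ler_wpM2l ?subr_ge0 // le_max lexx orbT.
  have : Num.max `|z0 - p.2.1| `|z0 - p.2.2| < r by rewrite gt_max ur.
  by set m := Num.max _ _; set a := `|_|; set a' := `|_|; lra.
by split; [exact: df|exact: zv].
Unshelve. all: by end_near. Qed.
End C1.

(** * The multiplication of a Lie group in charts *)

Lemma open_chart_image (E M : topologicalType) (c : chart E M) (O : set M) :
  is_chart c -> open O -> open (chart_map c @` (chart_dom c `&` O)).
Proof.
move=> [[odom ocod] mapP invP _ cinv] oO.
have -> : chart_map c @` (chart_dom c `&` O) =
    chart_cod c `&` chart_inv c @^-1` O.
  apply/seteqP; split=> [_ [x [cx Ox] <-]|y [cy Oy]].
    by have [? xE] := mapP _ cx; split => //=; rewrite xE.
  by have [? yE] := invP _ cy; exists (chart_inv c y).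
rewrite openE => y [cy Oy]; apply: filterI.
  exact: open_nbhs_nbhs.
by apply: cinv => //; exact: open_nbhs_nbhs.
Qed.

Lemma is_chart_prod (E F M N : topologicalType) (a : chart E M) (b : chart F N) :
  is_chart a -> is_chart b -> is_chart (prod_chart a b).
Proof.
move=> [[oda oca] mapa inva cma cia] [[odb ocb] mapb invb cmb cib].
split => /=.
- split; rewrite openE => -[x y] [/= ax bx].
    by exists (chart_dom a, chart_dom b) => //; split; exact: open_nbhs_nbhs.
  by exists (chart_cod a, chart_cod b) => //; split; exact: open_nbhs_nbhs.
- move=> [x y] [/= /mapa[? xE] /mapb[? yE]]; split => //=.
  by rewrite xE yE.
- move=> [x y] [/= /inva[? xE] /invb[? yE]]; split => //=.
  by rewrite xE yE.
- move=> [x y] [/= ax bx]; apply: cvg_prod_nbhs.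
    by apply: (cvg_comp _ _ (@cvg_fst_nbhs _ _ (x, y))); exact: cma.
  by apply: (cvg_comp _ _ (@cvg_snd_nbhs _ _ (x, y))); exact: cmb.
- move=> [x y] [/= ax bx]; apply: cvg_prod_nbhs.
    by apply: (cvg_comp _ _ (@cvg_fst_nbhs _ _ (x, y))); exact: cia.
  by apply: (cvg_comp _ _ (@cvg_snd_nbhs _ _ (x, y))); exact: cib.
Qed.

Section insertions.
Context (R : realType) (V W : normedModType R).
(** The two injections into a product, needed as linear maps to express partial
    derivatives. *)
Definition insl (v : V) : V * W := (v, 0).
Definition insr (w : W) : V * W := (0, w).
Fact insl_linear : linear insl.
Proof. by move=> k u v; rewrite /insl; congr (_, _); rewrite /= scaler0 addr0. Qed.
Fact insr_linear : linear insr.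
Proof. by move=> k u v; rewrite /insr; congr (_, _); rewrite /= scaler0 addr0. Qed.
HB.instance Definition _ := GRing.isLinear.Build R V (V * W)%type *:%R insl insl_linear.
HB.instance Definition _ := GRing.isLinear.Build R W (V * W)%type *:%R insr insr_linear.
Lemma continuous_insl : continuous insl.
Proof. by move=> v; apply: cvg_prod_nbhs; [exact: cvg_id|exact: cvg_cst]. Qed.
Lemma continuous_insr : continuous insr.
Proof. by move=> v; apply: cvg_prod_nbhs; [exact: cvg_cst|exact: cvg_id]. Qed.

Context (X : normedModType R) (f : V * W -> X) (L : {linear (V * W)%type -> X}).
Context (T : topologicalType) (t0 : T) (v0 : V) (w0 : W).
Hypothesis (cL : continuous L).

(** The first variable may follow the parameter: strictness in both variables
    jointly gives strictness in [w], uniformly in the first one. *)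
Lemma strict_diff_partial_right (s : T -> V) : s t @[t --> t0] --> v0 -> s t0 = v0 ->
  strict_diff (fun _ : T => f) t0 (v0, w0) L ->
  strict_diff (fun t w => f (s t, w)) t0 w0 (L \o insr).
Proof.
move=> cs s0 df.
apply: (@strict_diff_comp _ _ _ _ _ (fun t w => (s t, w)) (fun _ => f)) => //.
- exact: continuous_insr.
- rewrite /jointly_continuous_at /= s0; apply: cvg_prod_nbhs.
    by apply: (cvg_comp _ _ (@cvg_fst_nbhs _ _ _)).
  exact: cvg_snd_nbhs.
- apply: strict_diff_affine => t u v; rewrite /insr; congr (_, _).
  by rewrite /= subrr.
- by rewrite s0.
Qed.

Lemma strict_diff_partial_left :
  strict_diff (fun _ : T => f) t0 (v0, w0) L ->
  strict_diff (fun (_ : T) v => f (v, w0)) t0 v0 (L \o insl).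
Proof.
move=> df.
apply: (@strict_diff_comp _ _ _ _ _ (fun _ v => (v, w0)) (fun _ => f)) => //.
- exact: continuous_insl.
- rewrite /jointly_continuous_at /=; apply: cvg_prod_nbhs; last exact: cvg_cst.
  exact: cvg_snd_nbhs.
- apply: strict_diff_affine => t u v; rewrite /insl; congr (_, _).
  by rewrite /= subrr.
Qed.
End insertions.

Section lie.
Context (R : realType) (d : nat) (G : lieGroupType R d).
Implicit Types (a b c : chart 'rV[R]_d G) (g h : G).
Local Notation E := 'rV[R]_d.
Local Notation atlas := (@lie_atlas R d G).

Lemma mulg_continuous : continuous (fun p : G * G => (p.1 * p.2)%g).
Proof. exact: (@lie_mul_smooth R d G).1. Qed.

Definition mulg_in_charts a b c (p : E * E) : E :=
  chart_map c (chart_inv a p.1 * chart_inv b p.2)%g.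

Lemma mulg_in_charts_C1 a b c g h (T : topologicalType) (t0 : T) :
  atlas a -> atlas b -> atlas c ->
  chart_dom a g -> chart_dom b h -> chart_dom c (g * h)%g ->
  let z := (chart_map a g, chart_map b h) in
  differentiable (mulg_in_charts a b c) z /\
  strict_diff (fun _ : T => mulg_in_charts a b c) t0 z
    ('d (mulg_in_charts a b c) z).
Proof.
move=> Aa Ab Ac ag bh cgh z.
have [chartP _ _] := @lie_atlasP R d G.
have smooth := (@lie_mul_smooth R d G).2 (prod_chart a b) c
  (ex_intro _ a (ex_intro _ b (And3 Aa Ab erefl))) Ac.
set D := (X in smooth_on X _) in smooth.
have Dz : D z by exists (g, h).
have oD : open D.
  apply: open_chart_image; first by apply: is_chart_prod; exact: chartP.
  apply: open_comp; first by move=> p _; exact: mulg_continuous.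
  by have [[]] := chartP _ Ac.
split; first exact: (smooth 1%N).1.
apply: (@C1_strict_diff _ _ _ _ ('I_d + 'I_d)%type
  (fun i => match i with inl j => insl E (delta_mx 0 j)
                       | inr j => insr E (delta_mx 0 j) end)
  (fun i v => match i with inl j => v.1 0 j | inr j => v.2 0 j end)
  D) => //.
- move=> [u v]; rewrite big_sumType /=.
  transitivity (insl E u + insr E v).
    by congr (_, _); rewrite /= ?addr0 ?add0r.
  rewrite [in LHS](row_sum_delta u) [in LHS](row_sum_delta v) !linear_sum.
  by congr (_ + _); apply: eq_bigr => i _; rewrite linearZ.
- move=> [j|j] v; apply: le_trans (ler_coord_norm _ j) _.
    by rewrite prod_normE le_max lexx.
  by rewrite prod_normE le_max lexx orbT.
Qed.

Lemma chart_mapK c g : atlas c -> chart_dom c g -> chart_inv c (chart_map c g) = g.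
Proof. by have [cP _ _] := @lie_atlasP R d G => /cP[_ mapK _ _ _] /mapK[]. Qed.

Lemma chart_invK c u : atlas c -> chart_cod c u -> chart_map c (chart_inv c u) = u.
Proof. by have [cP _ _] := @lie_atlasP R d G => /cP[_ _ invK _ _] /invK[]. Qed.

Lemma near_chart_dom c g : atlas c -> chart_dom c g ->
  \forall h \near g, chart_dom c h.
Proof.
have [cP _ _] := @lie_atlasP R d G => /cP[[oc _] _ _ _ _] cg.
exact: open_nbhs_nbhs.
Qed.

Lemma near_chart_cod c g : atlas c -> chart_dom c g ->
  \forall u \near chart_map c g, chart_cod c u.
Proof.
have [cP _ _] := @lie_atlasP R d G => /cP[[_ oc] mapK _ _ _] /mapK[cg _].
exact: open_nbhs_nbhs.
Qed.

Lemma chart_map_cvg c g : atlas c -> chart_dom c g ->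
  chart_map c h @[h --> g] --> chart_map c g.
Proof. by have [cP _ _] := @lie_atlasP R d G => /cP[_ _ _ cc _]; exact: cc. Qed.

Lemma chart_inv_cvg c g : atlas c -> chart_dom c g ->
  chart_inv c u @[u --> chart_map c g] --> g.
Proof.
move=> Ac cg; rewrite -[X in _ --> X](chart_mapK Ac cg).
have [cP _ _] := @lie_atlasP R d G; have [_ mapK _ _ cc] := cP _ Ac.
by apply: cc; have [] := mapK _ cg.
Qed.

Lemma mulg_cvg (I : Type) (F : set_system I) {FF : Filter F} (f f' : I -> G)
    g g' :
  f i @[i --> F] --> g -> f' i @[i --> F] --> g' ->
  (f i * f' i)%g @[i --> F] --> (g * g')%g.
Proof.
move=> fg fg'.
exact: (@cvg_comp _ _ _ (fun i => (f i, f' i)) (fun p : G * G => p.1 * p.2)%g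
  _ _ _ (cvg_prod_nbhs fg fg') (@mulg_continuous (g, g'))).
Qed.

Lemma expg_continuous n : continuous (fun x : G => (x ^+ n)%g).
Proof.
move=> x; elim: n => [|n IHn]; first exact: cvg_cst.
rewrite /continuous_at.
under eq_fun do rewrite expgS.
by rewrite expgS; apply: mulg_cvg; [exact: cvg_id|exact: IHn].
Qed.

(** * Rigidity of torsion elements and closed conjugacy classes *)

(** A nearby [y] killed by [n] is conjugate to [x] by a fixed point of
    [k |-> y k x^-1], which [periodic_family_fixpoint] provides in a chart
    around [1]. *)
Lemma torsion_locally_conjugate (n : nat) (x : G) : (0 < n)%N ->
  (x ^+ n = 1)%g ->
  \forall y \near x, (y ^+ n = 1)%g -> exists k : G, y = (k * x * k^-1)%g.
Proof.
move=> n0 xn.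
have [_ cover _] := @lie_atlasP R d G.
have [c Ac c1] := cover 1%g.
have [a Aa ax] := cover x.
have [b Ab bx] := cover (x^-1)%g.
have bx' : chart_dom b (1 * x^-1)%g by rewrite mul1g.
have cx' : chart_dom c (x * x^-1)%g by rewrite mulgV.
have cx'' : chart_dom c (x * (1 * x^-1))%g by rewrite mul1g.
have [dN sN] := mulg_in_charts_C1 x Ac Ab Ab c1 bx bx'.
have [dM sM] := mulg_in_charts_C1 x Aa Ab Ac ax bx cx'.
(* [rho] is right translation by [x^-1] and [F y] is [k |-> y k x^-1], both read
   in charts; [F y] is a composite of partial maps of the multiplication. *)
pose N := mulg_in_charts c b b.
pose M := mulg_in_charts a b c.
pose u0 := chart_map c 1%g.
pose w0 := chart_map b (x^-1)%g.
pose rho (y : G) (u : E) := N (u, w0).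
pose F (y : G) (u : E) := M (chart_map a y, rho y u).
have rho0 : rho x u0 = w0.
  by rewrite /rho /N /mulg_in_charts /= !chart_mapK // mul1g.
have F0 : F x u0 = u0.
  by rewrite /F rho0 /M /mulg_in_charts /= !chart_mapK // mulgV.
have crho : jointly_continuous_at rho x u0.
  have h : (p.2, w0) @[p --> (x, u0)] --> (u0, w0).
    by apply: cvg_prod_nbhs; [exact: cvg_snd_nbhs|exact: cvg_cst].
  exact: (cvg_comp _ _ h (differentiable_continuous dN)).
have cF : jointly_continuous_at F x u0.
  have h : (chart_map a p.1, rho p.1 p.2) @[p --> (x, u0)] -->
      (chart_map a x, w0).
    apply: cvg_prod_nbhs; last by rewrite -rho0.
    by apply: (cvg_comp _ _ (@cvg_fst_nbhs _ _ _)); exact: chart_map_cvg.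
  rewrite /jointly_continuous_at {2}/F rho0.
  exact: (cvg_comp _ _ h (differentiable_continuous dM)).
pose z1 := (u0, w0); pose z2 := (chart_map a x, w0).
pose L1 : {linear E -> E} := 'd N z1 \o @insl R E E.
pose L2 : {linear E -> E} := 'd M z2 \o @insr R E E.
have cL1 : continuous L1.
  by move=> v; apply: continuous_comp; [exact: continuous_insl|exact: diff_continuous].
have cL2 : continuous L2.
  by move=> v; apply: continuous_comp; [exact: continuous_insr|exact: diff_continuous].
have dF : strict_diff F x u0 (L2 \o L1).
  apply: (@strict_diff_comp _ _ _ _ _ rho
    (fun y w => M (chart_map a y, w)) x u0 L1 L2 cL1 cL2 crho).
    exact: (@strict_diff_partial_left R E E E N ('d N z1) G x u0 w0
      (diff_continuous dN) sN).
  rewrite rho0.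
  exact: (@strict_diff_partial_right R E E E M ('d M z2) G x (chart_map a x) w0
    (diff_continuous dM) _ (chart_map_cvg Aa ax) erefl sM).
have cA : continuous (L2 \o L1).
  by move=> v; apply: continuous_comp; [exact: cL1|exact: cL2].
(* The chart expressions have their intended meaning only near [(x, u0)]. *)
have c_near : \forall p \near (x, u0), [/\ chart_cod c p.2,
    chart_cod c (F p.1 p.2) &
    chart_inv c (F p.1 p.2) = (p.1 * chart_inv c p.2 * x^-1)%g].
  have cc : chart_inv c p.2 @[p --> (x, u0)] --> (1%g : G).
    by apply: (cvg_comp _ _ (@cvg_snd_nbhs _ _ _)); exact: chart_inv_cvg.
  have cp : p.1 @[p --> (x, u0)] --> x by exact: cvg_fst_nbhs.
  have c1x : (chart_inv c p.2 * x^-1)%g @[p --> (x, u0)] --> (1 * x^-1)%g.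
    by apply: mulg_cvg => //; exact: cvg_cst.
  have cyx : (p.1 * (chart_inv c p.2 * x^-1))%g @[p --> (x, u0)] -->
      (x * (1 * x^-1))%g.
    exact: mulg_cvg.
  have nc : \forall u \near F x u0, chart_cod c u.
    by rewrite F0; exact: near_chart_cod.
  near=> p.
  have FE : F p.1 p.2 = chart_map c (p.1 * chart_inv c p.2 * x^-1)%g.
    rewrite /F /rho /M /N /mulg_in_charts /= (chart_mapK Ab bx).
    rewrite (chart_mapK Aa); last by near: p; exact: (cp _ (near_chart_dom Aa ax)).
    rewrite (chart_mapK Ab); last by near: p; exact: (c1x _ (near_chart_dom Ab bx')).
    by rewrite mulgA.
  split.
  - by near: p; exact: (@cvg_snd_nbhs _ _ (x, u0) _ (near_chart_cod Ac c1)).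
  - by near: p; exact: (cF _ nc).
  rewrite FE chart_mapK // -mulgA; near: p.
  by exact: (cyx _ (near_chart_dom Ac cx'')).
pose S := [set y : G | (y ^+ n = 1)%g].
have Fn : \forall p \near (x, u0), S p.1 -> iter n (F p.1) p.2 = p.2.
  near=> p => Sp.
  have it : forall i : 'I_n,
      [/\ chart_cod c (iter i (F p.1) p.2), chart_cod c (iter i.+1 (F p.1) p.2) &
      chart_inv c (iter i.+1 (F p.1) p.2) =
        (p.1 * chart_inv c (iter i (F p.1) p.2) * x^-1)%g].
    near: p; apply: filter_forall => i.
    have h : (p.1, iter i (F p.1) p.2) @[p --> (x, u0)] --> (x, u0).
      apply: cvg_prod_nbhs; first exact: cvg_fst_nbhs.
      have := jointly_continuous_iter F0 cF (i := i).
      by rewrite /jointly_continuous_at iter_fix.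
    exact: (h _ c_near).
  have inv_iter i : (i <= n)%N -> chart_inv c (iter i (F p.1) p.2) =
      (p.1 ^+ i * chart_inv c p.2 * (x ^+ i)^-1)%g.
    elim: i => [|i IHi] ltin; first by rewrite !expg0 invg1 mul1g mulg1.
    have [_ _ /= ->] := it (Ordinal ltin).
    by rewrite /= (IHi (ltnW ltin)) !expgS invgM !mulgA.
  have [cp _ _] := it (Ordinal n0).
  have lt_pn : (n.-1 < n)%N by rewrite prednK.
  have [_ + _] := it (Ordinal lt_pn); rewrite /= -iterS prednK // => cn.
  rewrite -(chart_invK Ac cn) inv_iter // Sp xn invg1 mul1g mulg1.
  exact: chart_invK.
case: c_near => -[U1 U2] /= [nU1 nU2] UU.
have := @periodic_family_fixpoint _ _ _ _ _ _ (L2 \o L1) cA F0 cF dF n S U2 n0 xn Fn nU2.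
apply: filterS2 nU1 => y U1y yfix yn.
have [u U2u Fu] := yfix yn.
exists (chart_inv c u).
have [_ _] := UU (y, u) (conj U1y U2u); rewrite /= Fu => uE.
by rewrite {1}uE mulgVK mulgK.
Unshelve. all: by end_near. Qed.

Lemma expg_conj n (k g : G) : ((k * g * k^-1) ^+ n = k * g ^+ n * k^-1)%g.
Proof.
elim: n => [|n IHn]; first by rewrite !expg0 mulg1 mulgV.
by rewrite !expgS IHn !mulgA mulgVK.
Qed.

Lemma conjugacy_class_closed (n : nat) (C : set G) : (0 < n)%N ->
  is_conjugacy_class C -> class_of_order n C -> closed C.
Proof.
move=> n0 [g ->] [_ [h _ <-] hn] z cz.
have gn : (g ^+ n = 1)%g.
  apply/eqP; rewrite -(inj_eq (mulgI h)) -(inj_eq (mulIg h^-1)%g) -expg_conj.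
  by rewrite mulg1 mulgV; apply/eqP.
have Cn y : conjugacy_class g y -> (y ^+ n = 1)%g.
  by move=> [k _ <-]; rewrite expg_conj gn mulg1 mulgV.
have zn : (z ^+ n = 1)%g.
  have ce : closed [set y : G | (y ^+ n = 1)%g].
    rewrite (_ : mkset _ = (fun y : G => (y ^+ n)%g) @^-1` [set 1%g]) //.
    apply: closed_comp; first by move=> y _; exact: expg_continuous.
    exact/accessible_closed_set1/hausdorff_accessible/lie_hausdorff.
  by apply: ce; exact: (closure_subset Cn).
(* The class meets the neighbourhood of [z] on which rigidity holds. *)
have [y [[k _ <-] rig]] := cz _ (torsion_locally_conjugate n0 zn).
have [l lE] := rig (Cn _ (ex_intro2 _ _ k I erefl)).
exists (l^-1 * k)%g => //.
rewrite invgM invgK; transitivity (l^-1 * (k * g * k^-1) * l)%g.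
  by rewrite !mulgA.
by rewrite lE !mulgA mulVg mul1g mulgVK.
Qed.

End lie.

Theorem corollary3p5 (R : realType) (d : nat) (G : lieGroupType R d) :
  connected [set: G] ->
  forall n : nat, (0 < n)%N ->
  forall C : set G, is_conjugacy_class C -> class_of_order n C -> closed C.
Proof. by move=> _ n n0 C; exact: conjugacy_class_closed. Qed.
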